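(* For cycles $A$ and $B$ sharing exactly one edge (i.e. $V(A)\cap V(B)=\{x,y\}$ with $xy\in E(A)\cap E(B)$), let $G=A\oplus B$ be the graph with vertex set $V(A)\cup V(B)$ and edge set $E(A)\cup E(B)$. Then: (i) If $A=C_{2k+1}$ and $B=C_{2l+1}$ with $l\geq k\geq 1$, then $P_{DP}(G,m)=P(G,m)$ for every $m\in\mathbb{N}$. (ii) If $A=C_{2k+2}$ and $B=C_{2l+2}$ with $l\geq k\geq 1$, then for every integer $m\geq 3$, $$P_{DP}(G,m)=\frac{1}{m}\left[(m-1)^{2k+2l+3}-(m-1)^{2l+1}-(m-1)^{2k+1}-m-1\right].$$ (iii) If $A=C_{2k+1}$ and $B=C_{2l+2}$ with $k,l\geq 1$, then for every integer $m\geq 2$, $$P_{DP}(G,m)=\frac{1}{m}\left[(m-1)^{2k+2l+2}-(m-1)^{2k}-(m-1)^{2l+2}+1\right].$$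
   Context: All graphs are finite and simple; $C_r$ is the cycle on $r$ vertices. $P(G,m)$ denotes the chromatic polynomial of $G$. A cover of a graph $G$ is a pair $\mathcal{H}=(L,H)$ where $H$ is a graph and $L:V(G)\to\mathcal{P}(V(H))$ satisfies: (1) the sets $L(u)$, $u\in V(G)$, partition $V(H)$; (2) for every $u$, $H[L(u)]$ is complete; (3) if $E_H(L(u),L(v))\neq\emptyset$ then $u=v$ or $uv\in E(G)$; (4) if $uv\in E(G)$ then $E_H(L(u),L(v))$ is a matching (possibly empty). Here $E_H(S,U)$ is the set of edges of $H$ between $S$ and $U$. The cover is $m$-fold if $|L(u)|=m$ for all $u$. An $\mathcal{H}$-coloring is an independent set of $H$ of size $|V(G)|$. $P_{DP}(G,\mathcal{H})$ is the number of $\mathcal{H}$-colorings, and $P_{DP}(G,m)$ is the minimum of $P_{DP}(G,\mathcal{H})$ over all $m$-fold covers $\mathcal{H}$ of $G$. *)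

(* Defs.v *)
From mathcomp Require Import all_boot all_algebra.
Set Implicit Arguments. Unset Strict Implicit. Unset Printing Implicit Defensive.

Definition simple_graph (V : finType) (G : rel V) : Prop :=
  (forall u v, G u v = G v u) /\ (forall u, ~~ G u u).

(* Edge of the cycle traversing the duplicate-free sequence c (cyclically). *)
Definition cyc_edge (V : eqType) (c : seq V) (u v : V) : bool :=
  [&& u \in c, v \in c & (next c u == v) || (next c v == u)].

Definition is_cycle_sum (V : finType) (G : rel V) (cA cB : seq V) : Prop :=
  [/\ uniq cA, uniq cB, 3 <= size cA, 3 <= size cB &
  [/\ exists x y : V, [/\ x != y,
         (forall z, (z \in cA) && (z \in cB) = (z == x) || (z == y)),
         cyc_edge cA x y & cyc_edge cB x y],
      (forall z : V, (z \in cA) || (z \in cB)) &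
      (forall u v, G u v = cyc_edge cA u v || cyc_edge cB u v)]].

Definition is_cover (V : finType) (G : rel V) (HT : finType) (h : rel HT)
  (L : V -> {set HT}) : Prop :=
  [/\ simple_graph h,
      (forall u v, u != v -> [disjoint L u & L v]) /\ (forall x, exists u, x \in L u),
      (forall u x y, x \in L u -> y \in L u -> x != y -> h x y),
      (forall u v x y, x \in L u -> y \in L v -> h x y -> u = v \/ G u v) &
      (forall u v, G u v ->
         (forall x y y', x \in L u -> y \in L v -> y' \in L v -> h x y -> h x y' -> y = y') /\
         (forall x x' y, x \in L u -> x' \in L u -> y \in L v -> h x y -> h x' y -> x = x'))].

Definition m_fold (V : finType) (HT : finType) (L : V -> {set HT}) (m : nat) : Prop :=
  forall u, #|L u| = m.

Definition n_cover_colorings (V : finType) (HT : finType) (h : rel HT) : nat :=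
  #|[set I : {set HT} | [forall x in I, forall y in I, ~~ h x y] && (#|I| == #|V|)]|.

Definition P_DP_is (V : finType) (G : rel V) (m n : nat) : Prop :=
  (exists (HT : finType) (h : rel HT) (L : V -> {set HT}),
      is_cover G h L /\ m_fold L m /\ n_cover_colorings V h = n) /\
  (forall (HT : finType) (h : rel HT) (L : V -> {set HT}),
      is_cover G h L -> m_fold L m -> n <= n_cover_colorings V h).

Definition chrom (V : finType) (G : rel V) (m : nat) : nat :=
  #|[set f : {ffun V -> 'I_m} | [forall u, forall v, G u v ==> (f u != f v)]]|.

(* Main.v *)
(** Label every fibre of an m-fold cover by 'I_m and enlarge every matching to a
permutation, which only destroys colorings. Between two endpoints colored i and
j, a path with n edges has c_n + (-1)^n [j = s i] proper colorings, where s is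
the composite of the permutations along the path and
c_n = ((m-1)^n - (-1)^n) / m, because avoiding a permutation matrix is
multiplication by J - P. As G is an edge with two parallel paths having a and b
edges, summing over the colors of x and y turns the number of colorings into a
sum over i of
  (m-1) c_a c_b + (-1)^a c_b [s i <> r i] + (-1)^b c_a [t i <> r i]
    + (-1)^(a+b) [s i = t i <> r i],
with r, s, t the permutations of the edge and of the two paths. Each summand is
minimised separately according to the parities of a and b, and the minimum is
attained for r = 1 with s and t the identity or disjoint derangements. *)
Require Import Defs.
From mathcomp Require Import all_boot fingroup perm all_algebra ring lra zify.
Set Implicit Arguments. Unset Strict Implicit. Unset Printing Implicit Defensive.
Import GRing.Theory Num.Theory.
Local Open Scope ring_scope.

(** * Cycles opened at an edge; the cycle sum as an edge with two paths *)

Lemma cycle_cyc_edge (V : eqType) (c : seq V) (R : rel V) :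
  uniq c -> symmetric R ->
  (forall u v, cyc_edge c u v -> R u v) <-> path.cycle R c.
Proof.
move=> Uc Rsym; split=> [Rc | Rc u v].
  apply: cycle_from_next => // u cu; apply: Rc.
  by rewrite /cyc_edge cu mem_next cu eqxx.
case/and3P=> cu cv /orP[/eqP <- | /eqP <-]; first exact: next_cycle.
by rewrite Rsym next_cycle.
Qed.

Lemma path_rev_sym (V : eqType) (R : rel V) (x y : V) (p : seq V) :
  symmetric R -> path R x (rcons (rev p) y) = path R y (rcons p x).
Proof.
move=> Rsym; have -> : rcons (rev p) y = rev (y :: p) by rewrite rev_cons.
rewrite -(belast_rcons y p x) -{1}(last_rcons y p x) rev_path.
by apply: eq_path => u v; apply: Rsym.
Qed.

(** Rotate [c] to start at [x] or [y], whichever comes first on the edge. If [y] follows [x], the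
    rest runs from [y] back to [x] and must be reversed; otherwise it already runs from [x] to
    [y]. *)
Lemma cyc_edge_open (V : eqType) (c : seq V) (x y : V) :
  uniq c -> x != y -> cyc_edge c x y ->
  exists p, perm_eq c [:: x, y & p] /\
    forall R : rel V, symmetric R -> path.cycle R c = R x y && path R x (rcons p y).
Proof.
move=> Uc xy /and3P[cx cy /orP[] /eqP nxt].
  have [i s ci] := rot_to cx.
  have: next (x :: s) x = y by rewrite -ci next_rot.
  case: s ci => [|z s] ci; rewrite /= ?eqxx; first by move=> e; rewrite e eqxx in xy.
  move=> zy; subst z; exists (rev s); split.
    rewrite -(perm_rot i) ci !perm_cons perm_sym; apply/permPl/perm_rev.
  move=> R Rsym; rewrite -(rot_cycle i) ci /= path_rev_sym //.
have [i s ci] := rot_to cy.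
have: next (y :: s) y = x by rewrite -ci next_rot.
case: s ci => [|z s] ci; rewrite /= ?eqxx; first by move=> e; rewrite e eqxx in xy.
move=> zx; subst z; exists s; split.
  rewrite -(perm_rot i) ci; apply/seq.permP=> a /=; lia.
by move=> R Rsym; rewrite -(rot_cycle i) ci /= Rsym.
Qed.

(** Quantifying over symmetric [R] determines the edge set without listing it: each coloring
    condition on the edges is one such [R], hence becomes a condition along two paths. *)
Definition edge_and_two_paths (V : finType) (G : rel V) (x y : V) (p q : seq V) : Prop :=
  [/\ uniq ([:: x; y] ++ p ++ q), forall z, z \in [:: x; y] ++ p ++ q, symmetric G &
      forall R : rel V, symmetric R ->
        (forall u v, G u v -> R u v) <->
        [&& R x y, path R x (rcons p y) & path R x (rcons q y)]].

(** Both cycles are opened at the shared edge; the interiors are disjoint because only [x] and [y]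
    are common. *)
Lemma cycle_sum_two_paths (V : finType) (G : rel V) (cA cB : seq V) :
  is_cycle_sum G cA cB ->
  exists x y p q,
  [/\ edge_and_two_paths G x y p q, size cA = (size p).+2 & size cB = (size q).+2].
Proof.
case=> UA UB _ _ [[x [y [xy AB eA eB]]] cov GE].
have [p [pA RA]] := cyc_edge_open UA xy eA.
have [q [pB RB]] := cyc_edge_open UB xy eB.
exists x, y, p, q; split; rewrite ?(perm_size pA) ?(perm_size pB) //.
have Up := UA; have Uq := UB.
rewrite (perm_uniq pA) /= !inE !negb_or -andbA in Up.
rewrite (perm_uniq pB) /= !inE !negb_or -andbA in Uq.
case/and4P: Up => _ xp yp up; case/and4P: Uq => _ xq yq uq.
split.
- rewrite /= !inE !mem_cat !negb_or xy xp yp xq yq /= cat_uniq up uq /= andbT.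
  apply/hasPn=> z zq; apply/negP=> zp; have := AB z.
  rewrite (perm_mem pA) (perm_mem pB) !inE zp zq !orbT => /esym/orP[] /eqP zE.
    by rewrite -zE zp in xp.
  by rewrite -zE zp in yp.
- move=> z; have := cov z; rewrite (perm_mem pA) (perm_mem pB) !inE mem_cat.
  by do 2!case: (z == _).
- by move=> u v; rewrite !GE /cyc_edge !(andbCA (v \in _)) !(orbC (next _ v == u)).
(* The shared edge occurs in both opened cycles, so the two copies of [R x y] merge into one. *)
move=> R Rsym; transitivity (path.cycle R cA && path.cycle R cB); last first.
  by rewrite RA // RB // andbACA andbb.
split=> [GR | /andP[] /(cycle_cyc_edge UA Rsym) hA /(cycle_cyc_edge UB Rsym) hB u v].
  by apply/andP; split; apply/cycle_cyc_edge=> // u v e; apply: GR; rewrite GE e ?orbT.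
by rewrite GE => /orP[/hA | /hB].
Qed.

(** Disequality is a symmetric relation that holds on the edge and along both paths, since all
    listed vertices are distinct; so it contains [G]. *)
Lemma edge_and_two_paths_irr (V : finType) (G : rel V) (x y : V) (p q : seq V) :
  edge_and_two_paths G x y p q -> irreflexive G.
Proof.
case=> us _ _ Gpaths u; apply/negP=> Guu.
suff /(_ u u Guu) : forall v w, G v w -> v != w by rewrite eqxx.
move: us; rewrite /= !inE !mem_cat !negb_or cat_uniq -!andbA.
case/and5P=> xy xp xq yp /and4P[yq up pq uq].
have neq_path s : x \notin s -> y \notin s -> uniq s ->
    path (fun v w => v != w) x (rcons s y).
  move=> xs ys us; apply: (pairwise_sorted (s := x :: _)); rewrite -uniq_pairwise /=.
  by rewrite mem_rcons inE negb_or xy xs rcons_uniq ys us.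
apply/Gpaths; first by move=> v w; rewrite eq_sym.
by rewrite xy !neq_path.
Qed.

(** * Sums over colorings, one vertex at a time *)

Definition update (V : finType) (T : Type) (f : {ffun V -> T}) (v : V) (t : T) :
  {ffun V -> T} := [ffun u => if u == v then t else f u].

(** Iterated sums let the vertices of a path be eliminated in order, while [f] supplies the boundary
    colors outside [s]. *)
Fixpoint sum_over (V T : finType) (s : seq V) (F : {ffun V -> T} -> nat)
    (f : {ffun V -> T}) : nat :=
  if s is v :: s' then (\sum_t sum_over s' F (update f v t))%N else F f.

Lemma sum_over_cat (V T : finType) (s s' : seq V) (F : {ffun V -> T} -> nat)
    (f : {ffun V -> T}) :
  sum_over (s ++ s') F f = sum_over s (sum_over s' F) f.
Proof. by elim: s f => //= v s IH f; apply: eq_bigr. Qed.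

Lemma eq_in_sum_over (V T : finType) (s : seq V) (F F' : {ffun V -> T} -> nat)
    (f : {ffun V -> T}) :
  (forall g : {ffun V -> T}, (forall v, v \notin s -> g v = f v) -> F g = F' g) ->
  sum_over s F f = sum_over s F' f.
Proof.
elim: s f => [|v s IH] f FF' /=; first by apply: FF'.
apply: eq_bigr => t _; apply: IH => g gf; apply: FF' => u.
by rewrite inE negb_or => /andP[uv us]; rewrite gf // ffunE (negPf uv).
Qed.

(** Group the colorings by their value at the head of [s]; since [s] has no repetition, that value
    is never overwritten later. *)
Lemma sum_over_agree (V T : finType) (s : seq V) (F : {ffun V -> T} -> nat)
    (f : {ffun V -> T}) :
  uniq s ->
  (\sum_(g : {ffun V -> T} | [forall v, (v \notin s) ==> (g v == f v)]) F g)%N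
    = sum_over s F f.
Proof.
elim: s f => [|v s IH] f /= => [_ | /andP[vs us]].
  rewrite (big_pred1 f) // => g /=; apply/forallP/eqP => [gf | -> u]; last exact: eqxx.
  by apply/ffunP=> u; apply/eqP/gf.
rewrite (partition_big (fun g : {ffun V -> T} => g v) predT) //=.
apply: eq_bigr => t _; rewrite -IH //; apply: eq_bigl => g.
apply/andP/forallP => [[/forallP gf /eqP gv] u | gf].
  apply/implyP=> us'; rewrite ffunE; case: (eqVneq u v) => [-> | uv]; first exact/eqP.
  by apply: (implyP (gf u)); rewrite inE negb_or uv.
split; last by have := implyP (gf v) vs; rewrite ffunE eqxx.
apply/forallP=> u; apply/implyP; rewrite inE negb_or => /andP[uv us'].
by have := implyP (gf u) us'; rewrite ffunE (negPf uv).
Qed.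

Lemma sum_over_all (V T : finType) (s : seq V) (F : {ffun V -> T} -> nat)
    (f : {ffun V -> T}) :
  uniq s -> (forall v, v \in s) -> (\sum_(g : {ffun V -> T}) F g)%N = sum_over s F f.
Proof.
move=> us cov; rewrite -sum_over_agree //; apply: eq_bigl => g.
by apply/esym/forallP=> v; rewrite cov.
Qed.

(** * Transfer along paths and closed form of the walk counts *)

(** [r u v] sends the color of [u] to the single color it forbids at [v]; the orientation matters,
    as [r v u] need not be the inverse. *)
Definition avoids (V : finType) (m : nat) (r : V -> V -> {perm 'I_m})
  (f : V -> 'I_m) : rel V := fun u v => f v != r u v (f u).

(* Number of proper colorings of the inner vertices p of the path u, p, y when
   u and y have colors i and j. *)
Fixpoint n_walks (V : finType) (m : nat) (r : V -> V -> {perm 'I_m})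
    (u : V) (p : seq V) (y : V) (i j : 'I_m) : nat :=
  if p is v :: p' then (\sum_(t | t != r u v i) n_walks r v p' y t j)%N
  else (j != r u y i).

(** Products of permutations act from left to right, so the factors appear in the order of
    travel. *)
Fixpoint holonomy (V : finType) (m : nat) (r : V -> V -> {perm 'I_m})
    (u : V) (p : seq V) (y : V) : {perm 'I_m} :=
  if p is v :: p' then (r u v * holonomy r v p' y)%g else r u y.

(** [K] stands for the rest of the summand; being constant in the inner vertices of this path, it
    factors out at every step of the induction. *)
Lemma sum_over_path (V : finType) (m : nat) (r : V -> V -> {perm 'I_m})
    (u : V) (p : seq V) (y : V) (K : {ffun V -> 'I_m} -> nat) (f : {ffun V -> 'I_m}) :
  uniq (u :: p) -> y \notin p ->
  (forall g : {ffun V -> 'I_m}, (forall v, v \notin p -> g v = f v) -> K g = K f) ->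
  sum_over p (fun g => path (avoids r g) u (rcons p y) * K g)%N f
    = (n_walks r u p y (f u) (f y) * K f)%N.
Proof.
elim: p u f K => [|v p IH] u f K /=; first by move=> _ _ _; rewrite andbT.
rewrite !inE !negb_or -andbA => /and4P[uv up vp Up] /andP[yv yp] Kf.
rewrite big_distrl [RHS]big_mkcond /=; apply: eq_bigr => t _.
have Kt (g : {ffun V -> 'I_m}) : (forall w, w \notin p -> g w = update f v t w) -> K g = K f.
  move=> gf; apply: Kf => w; rewrite inE negb_or => /andP[wv wp].
  by rewrite gf // ffunE (negPf wv).
have at_v : update f v t v = t by rewrite ffunE eqxx.
have at_u : update f v t u = f u by rewrite ffunE (negPf uv).
have at_y : update f v t y = f y by rewrite ffunE (negPf yv).
rewrite (@eq_in_sum_over _ _ _ _ (fun g : {ffun V -> 'I_m} =>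
  (path (avoids r g) v (rcons p y) * ((t != r u v (f u)) * K g))%N)) => [|g gf]; last first.
  rewrite {1}/avoids !gf // at_v at_u mulnA; congr (_ * _)%N.
  by rewrite mulnC; case: (t != _); rewrite ?mul1n ?muln1.
have Kt' (g : {ffun V -> 'I_m}) : (forall w, w \notin p -> g w = update f v t w) ->
    ((t != r u v (f u)) * K g = (t != r u v (f u)) * K (update f v t))%N.
  by move=> gf; rewrite (Kt g) // (Kt (update f v t)).
rewrite (IH v _ _ _ yp Kt') /= ?vp ?Up // at_v at_y.
by rewrite (Kt (update f v t)) //; case: (t != _); rewrite ?mul1n ?mul0n ?muln0.
Qed.

(** Once [x] and [y] are colored, the two interiors are independent: [q] is summed first with the
    condition on [p] as constant factor, then [p]. *)
Lemma sum_two_paths (V : finType) (m : nat) (r : V -> V -> {perm 'I_m})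
    (x y : V) (p q : seq V) :
  (0 < m)%N -> uniq ([:: x; y] ++ p ++ q) -> (forall z, z \in [:: x; y] ++ p ++ q) ->
  (\sum_(f : {ffun V -> 'I_m})
     [&& avoids r f x y, path (avoids r f) x (rcons p y) & path (avoids r f) x (rcons q y)]
   = \sum_i \sum_(j | j != r x y i) n_walks r x p y i j * n_walks r x q y i j)%N.
Proof.
(* The base coloring is arbitrary, since every vertex gets overwritten; [m0] only provides a
   color. *)
move=> m0 us cov; pose i0 : 'I_m := Ordinal m0.
rewrite (sum_over_all _ [ffun=> i0] us cov) /=.
move: us; rewrite /= !inE !mem_cat !negb_or cat_uniq -!andbA.
case/and5P=> xy xp xq yp /and4P[yq up pq uq].
have qp v : v \in p -> v \notin q by move=> vp; apply: contra pq => vq; apply/hasP; exists v.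
apply: eq_bigr => i _; rewrite [RHS]big_mkcond; apply: eq_bigr => j _.
rewrite sum_over_cat; set f := update _ y j.
have fx : f x = i by rewrite /f !ffunE (negPf xy) eqxx.
have fy : f y = j by rewrite /f !ffunE eqxx.
rewrite (@eq_in_sum_over _ _ _ _ (fun g : {ffun V -> 'I_m} =>
  (path (avoids r g) x (rcons p y) * ((j != r x y i) * n_walks r x q y i j))%N)) => [|g gf].
  rewrite sum_over_path ?fx ?fy //= ?xp // mulnA mulnAC.
  by case: (j != _); rewrite ?muln1 ?muln0.
have gx : g x = i by rewrite gf.
have gy : g y = j by rewrite gf.
rewrite (@eq_in_sum_over _ _ _ _ (fun k : {ffun V -> 'I_m} =>
  (path (avoids r k) x (rcons q y) *
     (avoids r k x y && path (avoids r k) x (rcons p y)))%N)) => [|k _]; last first.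
  by rewrite andbA andbC mulnb.
rewrite sum_over_path /= ?xq //; last first.
  move=> k kg; have kp v : v \in x :: rcons p y -> k v = g v.
    by rewrite inE mem_rcons inE => /or3P[] => [/eqP->|/eqP->|/qp]; apply: kg.
  rewrite /avoids !kp ?inE ?mem_rcons ?inE ?eqxx ?orbT //.
  congr (nat_of_bool (_ && _)); apply: (@eq_in_path _ (mem (x :: rcons p y))); last exact/allP.
  by move=> v w vp wp; rewrite /= !kp.
by rewrite /avoids gx gy -mulnb mulnC -mulnA mulnCA.
Qed.

(* The coefficient ((m-1)^n - (-1)^n) / m with q = m - 1, defined by its
   recurrence so that it makes sense without division. *)
Fixpoint walk_coef (R : pzRingType) (q : R) (n : nat) : R :=
  if n is n'.+1 then q * walk_coef q n' + (-1) ^+ n' else 0.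

Lemma walk_coefE (R : comPzRingType) (q : R) (n : nat) :
  (q + 1) * walk_coef q n = q ^+ n - (-1) ^+ n.
Proof.
elim: n => [|n IH] /=; first by rewrite mulr0 !expr0 subrr.
rewrite mulrDr mulrCA IH !exprS; ring.
Qed.

Lemma sum_neq (R : zmodType) (I : finType) (a : I) (F : I -> R) :
  \sum_(j | j != a) F j = \sum_j F j - F a.
Proof. by rewrite [in RHS](bigD1 a) //= addrC addrK. Qed.

Lemma sum_affine_delta (R : pzRingType) (m : nat) (c e : R) (a : 'I_m) :
  \sum_(j : 'I_m) (c + e * (j == a)%:R) = m%:R * c + e.
Proof.
rewrite big_split /= sumr_const card_ord mulr_natl; congr (_ + _).
by rewrite (bigD1 a) //= eqxx mulr1 big1 ?addr0 // => j /negPf ->; rewrite mulr0.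
Qed.

(** Summing a constant plus a delta over all colors but one gives the same shape: the constant obeys
    the recurrence of [walk_coef], and the delta changes sign and is transported by [r u v]. *)
Lemma n_walksE (R : comPzRingType) (V : finType) (m : nat) (r : V -> V -> {perm 'I_m})
    (u : V) (p : seq V) (y : V) (i j : 'I_m) :
  (n_walks r u p y i j)%:R =
    walk_coef (m%:R - 1) (size p).+1
      + (-1) ^+ (size p).+1 * (j == holonomy r u p y i)%:R :> R.
Proof.
elim: p u i => [|v p IH] u i.
  rewrite /= mulr0 add0r expr0 expr1 mulN1r.
  by case: (j == _); rewrite /= ?subrr ?subr0.
rewrite [n_walks _ _ _ _ _ _]/= natr_sum (eq_bigr _ (fun t _ => IH v t)) sum_neq.
rewrite [holonomy _ _ _ _]/= permM.
have delta t : (j == holonomy r v p y t) = (t == (holonomy r v p y)^-1%g j).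
  by rewrite -(inj_eq (@perm_inj _ (holonomy r v p y)) t) permKV eq_sym.
under eq_bigr => t _ do rewrite delta.
rewrite sum_affine_delta [size (v :: p)]/= [(-1) ^+ (size p).+2]exprS.
rewrite -[walk_coef _ (size p).+2]/((m%:R - 1) * walk_coef (m%:R - 1) (size p).+1
  + (-1) ^+ (size p).+1).
ring.
Qed.

Lemma sum_affine_delta2 (R : comPzRingType) (m : nat) (a b e d : R) (k s t : 'I_m) :
  \sum_(j | j != k) (a + e * (j == s)%:R) * (b + d * (j == t)%:R) =
    (m%:R - 1) * a * b + e * b * (s != k)%:R + d * a * (t != k)%:R
      + e * d * ((s == t) && (s != k))%:R.
Proof.
(* A product of deltas at [s] and [t] is the delta at [s] times [[s = t]]. The summand is split,
   with a dummy [0], into two pieces of the form handled by [sum_affine_delta]. *)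
have delta_mul (j : 'I_m) : (a + e * (j == s)%:R) * (b + d * (j == t)%:R)
    = (a * b + (e * b + e * d * (s == t)%:R) * (j == s)%:R)
      + (0 + d * a * (j == t)%:R).
  case: (eqVneq j s) => [->|_]; last by case: (j == t); rewrite /= ?mulr1n ?mulr0n; ring.
  by case: (s == t); rewrite /= ?mulr1n ?mulr0n; ring.
rewrite (eq_bigr _ (fun j _ => delta_mul j)) sum_neq big_split /= !sum_affine_delta.
rewrite -delta_mul ![k == _]eq_sym.
case: (eqVneq s k) => [->|sk].
  by rewrite eq_sym; case: (t == k); rewrite /= ?mulr1n ?mulr0n; ring.
case: (eqVneq t k) => [->|tk].
  by rewrite (negPf sk) /= ?mulr1n ?mulr0n; ring.
by case: (s == t); rewrite /= ?mulr1n ?mulr0n; ring.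
Qed.

(** * Permutations in place of matchings, labellings in place of covers *)

(** Domain and image of a matching have equal size, hence so do their complements. List the domain
    then its complement, the images in the same order then their complement, and pair equal
    positions. *)
Lemma matching_extends (m : nat) (M : rel 'I_m) :
  (forall i j j', M i j -> M i j' -> j = j') ->
  (forall i i' j, M i j -> M i' j -> i = i') ->
  exists s : {perm 'I_m}, forall i j, M i j -> j = s i.
Proof.
move=> Mfun Minj; pose D := [pred i | [exists j, M i j]].
pose g i := odflt i [pick j | M i j].
have gP i j : M i j -> g i = j.
  rewrite /g; case: pickP => [j' Mj' | none] /= Mj; first exact: Mfun Mj' Mj.
  by rewrite none in Mj.
have gD i : i \in D -> M i (g i) by case/existsP=> j Mj; rewrite (gP i j).
have ginj : {in D &, injective g}.
  by move=> i i' /gD Mi /gD Mi' e; apply: Minj Mi _; rewrite e.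
pose E := [set g i | i in D].
pose s1 := enum D ++ enum (predC D).
pose s2 := map g (enum D) ++ enum (predC (mem E)).
have size12 : size s1 = size s2.
  rewrite !size_cat size_map -!cardE; congr (_ + _)%N.
  by apply/eqP; rewrite -(eqn_add2l #|D|) cardC -[X in (X + _)%N](card_in_imset ginj) cardC.
have size1 : size s1 = m by rewrite size_cat -!cardE cardC card_ord.
have in1 i : i \in s1 by rewrite mem_cat !mem_enum orbN.
have uniq2 : uniq s2.
  rewrite cat_uniq enum_uniq map_inj_in_uniq ?enum_uniq ?andbT /=; last first.
    by move=> i i'; rewrite !mem_enum; apply: ginj.
  apply/hasPn=> j; rewrite mem_enum => jE; apply: contra jE => /mapP[i].
  by rewrite mem_enum => iD ->; apply: imset_f.
pose f i := nth i s2 (index i s1).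
have finj : injective f.
  move=> i i'; rewrite /f (set_nth_default i) -?size12 ?index_mem // => /eqP.
  rewrite nth_uniq -?size12 ?index_mem // => /eqP idx.
  by rewrite -(nth_index i (in1 i)) idx nth_index.
exists (perm finj) => i j Mij; rewrite permE /f.
have iD : i \in D by apply/existsP; exists j.
rewrite index_cat mem_enum iD nth_cat size_map index_mem mem_enum iD.
by rewrite (nth_map i) ?index_mem ?mem_enum // nth_index ?mem_enum // (gP i j).
Qed.

Lemma m_fold_labelling (V HT : finType) (L : V -> {set HT}) (m : nat) :
  m_fold L m ->
  exists e : V -> 'I_m -> HT,
    (forall u, injective (e u)) /\ (forall u z, z \in L u <-> exists i, z = e u i).
Proof.
move=> Lm; suff /fin_all_exists[e eP] : forall u, exists e : 'I_m -> HT,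
    injective e /\ forall z, z \in L u <-> exists i, z = e i.
  by exists e; split=> u; case: (eP u).
move=> u; exists (fun i => enum_val (cast_ord (esym (Lm u)) i)); split.
  by move=> i j /enum_val_inj/cast_ord_inj.
move=> z; split=> [zL | [i ->]]; last exact: enum_valP.
exists (cast_ord (Lm u) (enum_rank_in zL z)).
by rewrite cast_ordK enum_rankK_in.
Qed.

(** Fibres are cliques, so an independent set meets each at most once; having [#|V|] elements, it
    meets each exactly once and is the graph of a labelling. *)
Lemma n_cover_coloringsE (V HT : finType) (G : rel V) (h : rel HT)
    (L : V -> {set HT}) (m : nat) (e : V -> 'I_m -> HT) :
  is_cover G h L -> (forall u, injective (e u)) ->
  (forall u z, z \in L u <-> exists i, z = e u i) ->
  n_cover_colorings V h =
    (\sum_(f : {ffun V -> 'I_m})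
       [forall u, forall v, G u v ==> ~~ h (e u (f u)) (e v (f v))])%N.
Proof.
case=> [[hsym hirr] [Ldisj Lcov] Lcomplete Ledge _] einj eL.
have eLu u i : e u i \in L u by apply/eL; exists i.
have /fin_all_exists[cl clP] := Lcov.
have clE u z : z \in L u -> cl z = u.
  move=> zu; apply/eqP; apply: contraT => /Ldisj/pred0P/(_ z) /=.
  by rewrite clP zu.
pose S := [set f : {ffun V -> 'I_m} |
  [forall u, forall v, G u v ==> ~~ h (e u (f u)) (e v (f v))]].
pose I (f : {ffun V -> 'I_m}) := [set e u (f u) | u : V].
have einjV (f : {ffun V -> 'I_m}) : injective (fun u => e u (f u)).
  by move=> u v euv; rewrite -(clE u _ (eLu u (f u))) euv (clE v).
have Iinj : injective I.
  move=> f f' II'; apply/ffunP=> u; apply: (einj u).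
  have: e u (f u) \in I f' by rewrite -II'; apply: imset_f.
  case/imsetP=> v _ euv; have uv : u = v.
    by rewrite -(clE u _ (eLu u (f u))) euv (clE v).
  by rewrite euv -uv.
rewrite -big_mkcond /= sum1_card -(card_imset _ Iinj).
rewrite /n_cover_colorings; apply: eq_card => J; rewrite inE.
apply/andP/imsetP=> [[/forall_inP Jind /eqP JV] | [f fS ->]].
  have indep z w : z \in J -> w \in J -> ~~ h z w.
    by move=> zJ wJ; have /forall_inP := Jind z zJ; apply.
  have clinj : {in J &, injective cl}.
    move=> z w zJ wJ clzw; apply/eqP; apply: contraNT (indep z w zJ wJ) => zw.
    by apply: Lcomplete _ _ _ (clP z) _ zw; rewrite clzw; apply: clP.
  (* Injectivity of [cl] on [J] and the size of [J] force every fibre to be met. *)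
  have clJ : cl @: J = [set: V].
    by apply/eqP; rewrite eqEcard subsetT cardsT (card_in_imset clinj) JV leqnn.
  have /fin_all_exists[f fJ] : forall u, exists i, e u i \in J.
    move=> u; have /imsetP[z zJ uz] : u \in cl @: J by rewrite clJ.
    have /eL[i zi] := clP z; exists i; by rewrite uz -zi.
  have JI : J = I [ffun u => f u].
    apply/esym/eqP; rewrite eqEcard card_imset // JV leqnn andbT.
    by apply/subsetP=> z /imsetP[u _ ->]; rewrite ffunE.
  exists [ffun u => f u] => //; apply/forallP=> u; apply/forallP=> v; apply/implyP=> _.
  by apply: indep; rewrite ffunE.
split; last by rewrite card_imset.
apply/forall_inP=> z /imsetP[u _ ->]; apply/forall_inP=> w /imsetP[v _ ->].
apply/negP=> huv; have [uv | Guv] := Ledge _ _ _ _ (eLu u _) (eLu v _) huv.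
  by rewrite uv (negPf (hirr _)) in huv.
by have /forallP/(_ u)/forallP/(_ v)/implyP/(_ Guv) := fS; rewrite huv.
Qed.

(** * The coloring count as a sum of weights, and its comparison with covers *)

Definition n_avoiding (V : finType) (m : nat) (r : V -> V -> {perm 'I_m})
    (x y : V) (p q : seq V) : nat :=
  (\sum_(f : {ffun V -> 'I_m})
     [&& avoids r f x y, path (avoids r f) x (rcons p y) & path (avoids r f) x (rcons q y)])%N.

(** Contribution of one color of [x]: [k], [s], [t] are its images at [y] through the edge and the
    two paths, of [a] and [b] edges. *)
Definition vertex_weight (m : nat) (a b : nat) (k s t : 'I_m) : rat :=
  let c := walk_coef (m%:R - 1) in
  (m%:R - 1) * c a * c b + (-1) ^+ a * c b * (s != k)%:R
    + (-1) ^+ b * c a * (t != k)%:R + (-1) ^+ a * (-1) ^+ b * ((s == t) && (s != k))%:R.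

Lemma n_avoidingE (V : finType) (m : nat) (r : V -> V -> {perm 'I_m})
    (G : rel V) (x y : V) (p q : seq V) :
  (0 < m)%N -> edge_and_two_paths G x y p q ->
  (n_avoiding r x y p q)%:R =
    \sum_i vertex_weight (size p).+1 (size q).+1
             (r x y i) (holonomy r x p y i) (holonomy r x q y i).
Proof.
move=> m0 [us cov _ _]; rewrite /n_avoiding sum_two_paths // natr_sum.
apply: eq_bigr => i _; rewrite natr_sum /vertex_weight -sum_affine_delta2.
by apply: eq_bigr => j _; rewrite natrM !n_walksE.
Qed.

(** Enlarging each matching to a permutation only adds constraints, so every coloring counted on the
    left is a coloring of the cover. *)
Lemma n_avoiding_le_cover (V HT : finType) (G : rel V) (h : rel HT) (L : V -> {set HT})
    (m : nat) (x y : V) (p q : seq V) :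
  edge_and_two_paths G x y p q -> is_cover G h L -> m_fold L m ->
  exists r : V -> V -> {perm 'I_m}, (n_avoiding r x y p q <= n_cover_colorings V h)%N.
Proof.
move=> [_ _ Gsym Gpaths] coverL /m_fold_labelling[e [einj eL]].
have eLu u i : e u i \in L u by apply/eL; exists i.
have [[hsym _] _ _ _ Lmatch] := coverL.
have /fin_all_exists[r rP] : forall u, exists ru : V -> {perm 'I_m},
    forall v, G u v -> forall i j, h (e u i) (e v j) -> j = ru v i.
  move=> u; suff /fin_all_exists[ru] : forall v, exists s : {perm 'I_m},
      G u v -> forall i j, h (e u i) (e v j) -> j = s i by exists ru.
  move=> v; case Guv: (G u v); last by exists 1%g.
  have [hfun hinj] := Lmatch u v Guv.
  have [|| s sP] := @matching_extends m (fun i j => h (e u i) (e v j)); last by exists s.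
    by move=> i j j' hj hj'; apply: (einj v); apply: hfun hj hj'.
  by move=> i i' j hi hi'; apply: (einj u); apply: hinj hi hi'.
exists r; rewrite (n_cover_coloringsE coverL einj eL) /n_avoiding; apply: leq_sum => f _.
set good := [&& _, _ & _]; case goodE: good => //.
set proper := [forall u, _]; suff -> : proper by [].
(* The guard by [G] makes [R] follow from [avoids] for all pairs, so path membership transfers
   without checking adjacency of consecutive vertices. *)
pose R u v := G u v ==> ~~ h (e u (f u)) (e v (f v)).
have Rsym : symmetric R by move=> u v; rewrite /R Gsym hsym.
have avoidsR u v : avoids r f u v -> R u v.
  move=> av; apply/implyP=> Guv; apply: contra av => huv.
  by apply/eqP; apply: rP huv.
have GR : forall u v, G u v -> R u v.
  apply/Gpaths => //; case/and3P: goodE => /avoidsR -> pP pQ.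
  by rewrite !(sub_path avoidsR).
apply/forallP=> u; apply/forallP=> v; apply/implyP=> Guv.
by have := GR u v Guv; rewrite /R Guv.
Qed.

(** * Covers realising prescribed permutations *)

(** On [V * 'I_m], join [(u, i)] to [(v, j)] along an edge when [g u v i = g v u j]; then [i] at [u]
    forbids exactly the image of [i] under [g u v] followed by the inverse of [g v u]. *)
Lemma permutation_cover (V : finType) (G : rel V) (m : nat)
    (g : V -> V -> {perm 'I_m}) (x y : V) (p q : seq V) :
  edge_and_two_paths G x y p q ->
  exists (HT : finType) (h : rel HT) (L : V -> {set HT}),
    is_cover G h L /\ m_fold L m /\
    n_cover_colorings V h = n_avoiding (fun u v => g u v * (g v u)^-1)%g x y p q.
Proof.
move=> Gxy; have Girr := edge_and_two_paths_irr Gxy; have [_ _ Gsym Gpaths] := Gxy.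
pose h (z w : V * 'I_m) :=
  (z.1 == w.1) && (z.2 != w.2) || G z.1 w.1 && (g z.1 w.1 z.2 == g w.1 z.1 w.2).
pose L u := [set z : V * 'I_m | z.1 == u].
have coverL : is_cover G h L.
  split.
  - split=> [z w | z]; last by rewrite /h Girr !eqxx.
    by rewrite /h Gsym (eq_sym w.1) (eq_sym w.2) (eq_sym (g w.1 _ _)).
  - split=> [u v uv | z]; last by exists z.1; rewrite inE.
    by apply/pred0P=> z /=; rewrite !inE; case: (z.1 =P u) => //= ->; rewrite (negPf uv).
  - move=> u [z i] [w j]; rewrite !inE /h /= => /eqP -> /eqP -> zw.
    by rewrite eqxx; case: (eqVneq i j) zw => // ->; rewrite eqxx.
  - move=> u v z w; rewrite !inE /h => /eqP -> /eqP -> /orP[/andP[/eqP uv _] | /andP[Guv _]].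
      by left.
    by right.
  move=> u v Guv; have uv : (u == v) = false.
    by apply/negP=> /eqP uv; rewrite uv Girr in Guv.
  split=> [[z i] [w j] [w' j'] | [z i] [z' i'] [w j]]; rewrite !inE /h /=.
    move=> /eqP -> /eqP -> /eqP ->; rewrite uv Guv /= => /eqP -> /eqP e.
    by rewrite (perm_inj e).
  move=> /eqP -> /eqP -> /eqP ->; rewrite uv Guv /= => /eqP <- /eqP e.
  by rewrite (perm_inj e).
exists (V * 'I_m)%type, h, L; split=> //; split.
  move=> u; have -> : L u = [set (u, i) | i : 'I_m].
    apply/setP=> -[z i]; rewrite inE /=; apply/eqP/imsetP => [-> | [j _ [-> _]] //].
    by exists i.
  by rewrite card_imset ?card_ord // => i j [].
pose e (u : V) (i : 'I_m) := (u, i).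
have einj u : injective (e u) by move=> i j [].
have eL u z : z \in L u <-> exists i, z = e u i.
  rewrite inE; split=> [/eqP zu | [i ->]]; last exact: eqxx.
  by exists z.2; rewrite /e -zu; case: (z).
rewrite (n_cover_coloringsE coverL einj eL) /n_avoiding; apply: eq_bigr => f _.
congr nat_of_bool.
pose R u v := g u v (f u) != g v u (f v).
have Rsym : symmetric R by move=> u v; rewrite /R eq_sym.
have avoidsE : avoids (fun u v => g u v * (g v u)^-1)%g f =2 R.
  by move=> u v; rewrite /avoids /R permM -(inj_eq (@perm_inj _ (g v u)) (f v)) permKV eq_sym.
rewrite avoidsE !(eq_path avoidsE).
have GnR u v : G u v -> ~~ h (e u (f u)) (e v (f v)) = R u v.
  move=> Guv; rewrite /h /= Guv; case: eqVneq => //= uv.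
  by rewrite uv Girr in Guv.
apply/idP/idP=> [/forallP proper | good].
  apply/Gpaths => // u v Guv; rewrite -GnR //.
  by have /forallP/(_ v)/implyP := proper u; apply.
apply/forallP=> u; apply/forallP=> v; apply/implyP=> Guv.
by rewrite GnR //; have/Gpaths := good; apply.
Qed.

Lemma holonomy_trivial (V : finType) (m : nat) (r : V -> V -> {perm 'I_m})
    (u : V) (p : seq V) (y : V) :
  {in u :: rcons p y &, forall v w, r v w = 1%g} -> holonomy r u p y = 1%g.
Proof.
elim: p u => [|v p IH] u r1 /=; first by apply: r1; rewrite !inE eqxx ?orbT.
rewrite r1 ?inE ?eqxx ?orbT // mul1g; apply: IH => w w' wp wp'.
by apply: r1; rewrite inE ?wp ?wp' orbT.
Qed.

(** Proper colorings are those of the identity cover; [1 * 1^-1] is kept unsimplified to match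
    [permutation_cover] at the constant [g]. *)
Lemma chromE (V : finType) (G : rel V) (m : nat) (x y : V) (p q : seq V) :
  edge_and_two_paths G x y p q ->
  chrom G m = n_avoiding (fun _ _ => 1 * 1^-1 : {perm 'I_m})%g x y p q.
Proof.
case=> _ _ _ Gpaths; rewrite /chrom -sum1_card big_mkcond /=; apply: eq_bigr => f _.
rewrite inE -[LHS]/(nat_of_bool [forall u, forall v, G u v ==> (f u != f v)]).
congr nat_of_bool; pose R u v := f u != f v.
have Rsym : symmetric R by move=> u v; rewrite /R eq_sym.
have avoidsE : avoids (fun _ _ => 1 * 1^-1 : {perm 'I_m})%g f =2 R.
  by move=> u v; rewrite /avoids mulgV perm1 eq_sym.
rewrite avoidsE !(eq_path avoidsE).
apply/idP/idP=> [/forallP proper | good].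
  by apply/Gpaths => // u v Guv; have /forallP/(_ v)/implyP := proper u; apply.
apply/forallP=> u; apply/forallP=> v; apply/implyP=> Guv.
by have/Gpaths := good; apply.
Qed.

(* Only the first edge of each path carries a nontrivial permutation. Writing the
   cover condition as g u v i = g v u j makes it symmetric in the two ends. *)
Lemma n_avoiding_twisted (V : finType) (G : rel V) (m : nat) (x y : V) (p q : seq V)
    (s t : {perm 'I_m}) :
  (0 < m)%N -> edge_and_two_paths G x y p q -> (0 < size p)%N -> (0 < size q)%N ->
  exists g : V -> V -> {perm 'I_m},
    (n_avoiding (fun u v => g u v * (g v u)^-1)%g x y p q)%:R =
      \sum_i vertex_weight (size p).+1 (size q).+1 i (s i) (t i).
Proof.
(* Nonempty interiors give first edges [x v] and [x w] distinct from each other and from [x y], so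
   they can be twisted independently. *)
move=> m0 Gxy; case: p q Gxy => [|v p] [|w q] // Gxy _ _; have [us _ _ _] := Gxy.
pose g u u' := if u == x then if u' == v then s else if u' == w then t else 1%g
               else (1%g : {perm 'I_m}).

have xz z : z \in y :: (v :: p) ++ (w :: q) -> z != x.
  by apply: contraTneq => ->; case/andP: us.
have yz z : z \in (v :: p) ++ (w :: q) -> z != y.
  by apply: contraTneq => ->; case/and3P: us.
have vw : v != w.
  by case/and4P: us => _ _ vpq _; apply: contraNneq vpq => ->; rewrite mem_cat mem_head orbT.
exists g; rewrite (n_avoidingE _ m0 Gxy); apply: eq_bigr => i _.
set r := fun u u' => (g u u' * (g u' u)^-1)%g.
have r_x z : z != x -> r x z = g x z by move=> zx; rewrite /r {2}/g (negPf zx) invg1 mulg1.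
have r_off z z' : z != x -> z' != x -> r z z' = 1%g.
  by move=> zx z'x; rewrite /r /g (negPf zx) (negPf z'x) invg1 mulg1.
have xv : v != x by rewrite xz // !inE eqxx !orbT.
have xw : w != x by rewrite xz // inE mem_cat mem_head !orbT.
have sub_p : {subset v :: rcons p y <= y :: (v :: p) ++ (w :: q)}.
  by move=> z; rewrite /= !inE mem_rcons mem_cat !inE => /or3P[]->; rewrite ?orbT.
have sub_q : {subset w :: rcons q y <= y :: (v :: p) ++ (w :: q)}.
  by move=> z; rewrite /= !inE mem_rcons mem_cat !inE => /or3P[]->; rewrite ?orbT.
have -> : holonomy r x (v :: p) y = s.
  rewrite /= r_x // /g !eqxx holonomy_trivial ?mulg1 // => z z' zp zp'.
  by apply: r_off; apply: xz; apply: sub_p.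
have -> : holonomy r x (w :: q) y = t.
  rewrite /= r_x // /g !eqxx eq_sym (negPf vw) holonomy_trivial ?mulg1 // => z z' zq zq'.
  by apply: r_off; apply: xz; apply: sub_q.
rewrite -[X in vertex_weight _ _ X _ _]/(r x y i) r_x ?xz ?mem_head // /g eqxx.
rewrite eq_sym (negPf (yz v _)) ?mem_head // eq_sym (negPf (yz w _)) ?perm1 //.
by rewrite mem_cat mem_head orbT.
Qed.

(** Translations by 1 and by 2 in the integers modulo [m]; the second has no fixed point once 2 is
    nonzero, that is for [m > 2]. *)
Lemma exists_derangements (m : nat) : (1 < m)%N ->
  exists s t : {perm 'I_m}, (forall i, s i != i) /\ ((2 < m)%N -> forall i, t i != i /\ s i != t i).
Proof.
case: m => [|[|m]] // _.
have addl_inj (a : 'I_m.+2) : injective (fun i => a + i) by apply: addrI.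
exists (perm (@addl_inj 1)), (perm (@addl_inj (1 + 1))).
have shift (a i : 'I_m.+2) : (a + i == i) = (a == 0) by rewrite -subr_eq0 addrK.
split=> [i | m2 i]; first by rewrite permE shift oner_neq0.
have two_neq0 : (1 + 1 : 'I_m.+2) != 0.
  by rewrite -val_eqE /= !modn_small // addn1.
rewrite !permE shift -addrA [1 + i == _]eq_sym shift oner_neq0.
by [].
Qed.

(** * Termwise minimisation of the weights *)

Lemma sum_const_ord (m : nat) (F : 'I_m -> rat) (K : rat) :
  (forall i, F i = K) -> \sum_i F i = m%:R * K.
Proof. by move=> FK; rewrite (eq_bigr _ (fun i _ => FK i)) sumr_const card_ord mulr_natl. Qed.

(** The bound [K] is asked for each triple of colors separately, so it applies to whatever
    permutations a cover yields; summed over the [m] colors of [x] it meets the value attained by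
    [g]. *)
Lemma P_DP_minimum (V : finType) (G : rel V) (m : nat) (x y : V) (p q : seq V)
    (g : V -> V -> {perm 'I_m}) (K : rat) :
  (0 < m)%N -> edge_and_two_paths G x y p q ->
  (n_avoiding (fun u v => g u v * (g v u)^-1)%g x y p q)%:R = m%:R * K ->
  (forall k s t : 'I_m, K <= vertex_weight (size p).+1 (size q).+1 k s t) ->
  P_DP_is G m (n_avoiding (fun u v => g u v * (g v u)^-1)%g x y p q).
Proof.
move=> m0 Gxy gK Kmin; split; first exact: permutation_cover Gxy.
move=> HT h L coverL Lm; have [r] := n_avoiding_le_cover Gxy coverL Lm.
apply: leq_trans; rewrite -(ler_nat rat) gK (n_avoidingE _ m0 Gxy).
rewrite -[m in m%:R * _](card_ord m) mulr_natl -sumr_const; apply: ler_sum => i _.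
exact: Kmin.
Qed.

Lemma walk_coef_even (m n : nat) : (0 < m)%N -> ~~ odd n ->
  m%:R * walk_coef (m%:R - 1) n = (m%:R - 1) ^+ n - 1 :> rat.
Proof.
move=> m0 /negPf on; have := walk_coefE (m%:R - 1 : rat) n.
by rewrite subrK -signr_odd on expr0.
Qed.

Lemma walk_coef_odd (m n : nat) : (0 < m)%N -> odd n ->
  m%:R * walk_coef (m%:R - 1) n = (m%:R - 1) ^+ n + 1 :> rat.
Proof.
move=> m0 on; have := walk_coefE (m%:R - 1 : rat) n.
by rewrite subrK -signr_odd on expr1 opprK.
Qed.

Lemma predn_ge1 (m : nat) : (1 < m)%N -> 1 <= m%:R - 1 :> rat.
Proof. by move=> m1; have : 2%:R <= m%:R :> rat; [rewrite ler_nat | lra]. Qed.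

Lemma walk_coef_ge0 (m n : nat) : (1 < m)%N -> 0 <= walk_coef (m%:R - 1 : rat) n.
Proof.
move=> m1; have m0 : 0 < m%:R :> rat by rewrite ltr0n ltnW.
rewrite -(pmulr_rge0 _ m0).
have q1 := predn_ge1 m1.
have qn : 1 <= (m%:R - 1) ^+ n :> rat by apply: exprn_ege1.
case on: (odd n); first by rewrite (walk_coef_odd (ltnW m1) on); lra.
by rewrite (walk_coef_even (ltnW m1) (negbT on)); lra.
Qed.

(** With [q = m - 1] and [n] odd, [m] times the coefficient is [q ^ n + 1], at least [q + 1 = m]. *)
Lemma walk_coef_odd_ge1 (m n : nat) : (1 < m)%N -> odd n ->
  1 <= walk_coef (m%:R - 1 : rat) n.
Proof.
move=> m1 on; have m0 : 0 < m%:R :> rat by rewrite ltr0n ltnW.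
rewrite -(ler_pM2l m0) (walk_coef_odd (ltnW m1) on) mulr1 -lerBlDr.
have q1 := predn_ge1 m1.
case: n on => [//|n _]; rewrite exprS; apply: ler_peMr; first by lra.
exact: exprn_ege1.
Qed.

(** All three correction terms have a positive sign; they vanish when [s = t = k]. *)
Lemma vertex_weight_even_even (m a b : nat) (k s t : 'I_m) :
  (1 < m)%N -> ~~ odd a -> ~~ odd b ->
  (m%:R - 1) * walk_coef (m%:R - 1) a * walk_coef (m%:R - 1) b
    <= vertex_weight a b k s t.
Proof.
move=> m1 /negPf oa /negPf ob; rewrite /vertex_weight -(signr_odd _ a) -(signr_odd _ b) oa ob.
have := walk_coef_ge0 a m1; have := walk_coef_ge0 b m1.
set c := walk_coef _; move: (c a) (c b) => ca cb cb0 ca0; set K := _ * ca * cb.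
by case: (s != k) (t != k) (s == t) => [] [] []; rewrite /= ?mulr1n ?mulr0n; lra.
Qed.

(** Both single deltas help and the joint one hurts, so equality requires [k], [s], [t] pairwise
    distinct, hence three colors. *)
Lemma vertex_weight_odd_odd (m a b : nat) (k s t : 'I_m) :
  (1 < m)%N -> odd a -> odd b ->
  (m%:R - 1) * walk_coef (m%:R - 1) a * walk_coef (m%:R - 1) b
    - walk_coef (m%:R - 1) b - walk_coef (m%:R - 1) a <= vertex_weight a b k s t.
Proof.
move=> m1 oa ob; rewrite /vertex_weight -(signr_odd _ a) -(signr_odd _ b) oa ob.
have := walk_coef_ge0 a m1; have := walk_coef_ge0 b m1.
set c := walk_coef _; move: (c a) (c b) => ca cb cb0 ca0; set K := _ * ca * cb.
by case: (s != k) (t != k) (s == t) => [] [] []; rewrite /= ?mulr1n ?mulr0n; lra.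
Qed.

(** The joint term can gain 1, but only when [s] differs from [k], which costs the coefficient of
    the odd index [b], at least 1. Equality holds at [s = k], [t] different from [k]. *)
Lemma vertex_weight_even_odd (m a b : nat) (k s t : 'I_m) :
  (1 < m)%N -> ~~ odd a -> odd b ->
  (m%:R - 1) * walk_coef (m%:R - 1) a * walk_coef (m%:R - 1) b
    - walk_coef (m%:R - 1) a <= vertex_weight a b k s t.
Proof.
move=> m1 /negPf oa ob; rewrite /vertex_weight -(signr_odd _ a) -(signr_odd _ b) oa ob.
have := walk_coef_ge0 a m1; have := walk_coef_odd_ge1 m1 ob.
set c := walk_coef _; move: (c a) (c b) => ca cb cb1 ca0; set K := _ * ca * cb.
by case: (s != k) (t != k) (s == t) => [] [] []; rewrite /= ?mulr1n ?mulr0n; lra.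
Qed.

(** * The three parity cases *)

Lemma chrom_le1 (V : finType) (G : rel V) (m : nat) (x y : V) :
  (m <= 1)%N -> G x y -> chrom G m = 0%N.
Proof.
move=> m1 Gxy; apply: eq_card0 => f; rewrite inE; apply/negP=> /forallP/(_ x)/forallP/(_ y).
rewrite Gxy /= => /eqP[]; apply: val_inj.
by case: (f x) (f y) => i im [j jm] /=; lia.
Qed.

Lemma P_DP_odd_odd (V : finType) (G : rel V) (m : nat) (x y : V) (p q : seq V) :
  edge_and_two_paths G x y p q -> odd (size p) -> odd (size q) ->
  P_DP_is G m (chrom G m).
Proof.
move=> Gxy op oq; have [m1 | m1] := leqP m 1.
  (* With at most one color the chromatic count is 0, so the lower bound is immediate and the
     identity cover attains it. *)
  split=> [|HT h L _ _]; last first.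
    rewrite (@chrom_le1 _ _ _ x y) //; have [_ _ Gsym Gpaths] := Gxy.
    by have /Gpaths : forall u v, G u v -> G u v by []; case/(_ Gsym)/and3P.
  by rewrite (chromE m Gxy); apply: (permutation_cover (fun _ _ => 1%g) Gxy).
rewrite (chromE m Gxy); pose c := walk_coef (m%:R - 1 : rat).
apply: (@P_DP_minimum _ _ _ _ _ _ _ (fun _ _ => 1%g)
  ((m%:R - 1) * c (size p).+1 * c (size q).+1) (ltnW m1) Gxy).
  rewrite (n_avoidingE _ (ltnW m1) Gxy); apply: sum_const_ord => i.
  rewrite !holonomy_trivial => [|v w _ _|v w _ _]; rewrite ?mulgV //.
  by rewrite /vertex_weight perm1 eqxx /= !mulr0 !addr0.
by move=> k s t; apply: vertex_weight_even_even; rewrite //= negbK.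
Qed.

Lemma P_DP_even_even (V : finType) (G : rel V) (m : nat) (x y : V) (p q : seq V) :
  edge_and_two_paths G x y p q -> odd (size p).+1 -> odd (size q).+1 ->
  (0 < size p)%N -> (0 < size q)%N -> (2 < m)%N ->
  exists n : nat, P_DP_is G m n /\
    (n%:R : rat) = ((m%:R - 1) ^+ ((size p).+1 + (size q).+1).+1 - (m%:R - 1) ^+ (size q).+1
                    - (m%:R - 1) ^+ (size p).+1 - m%:R - 1) / m%:R.
Proof.
move=> Gxy op oq p0 q0 m2; have m1 : (1 < m)%N by rewrite ltnW.
have m0 : (0 < m)%N by rewrite ltnW.
(* Disjoint derangements make [i], [s i], [t i] pairwise distinct, so the bound is attained at every
   color of [x]. *)
have [s [t [s_der /(_ m2) t_der]]] := exists_derangements m1.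
have [g gE] := n_avoiding_twisted s t m0 Gxy p0 q0.
pose c := walk_coef (m%:R - 1 : rat); set a := (size p).+1; set b := (size q).+1.
pose K := (m%:R - 1) * c a * c b - c b - c a.
have weightE i : vertex_weight a b i (s i) (t i) = K.
  have [ti /negPf st] := t_der i.
  rewrite /vertex_weight st s_der ti -(signr_odd _ a) -(signr_odd _ b) op oq /K /c /= ?mulr1n ?mulr0n ?expr1; ring.
rewrite (sum_const_ord weightE) in gE.
exists (n_avoiding (fun u v => g u v * (g v u)^-1)%g x y p q); split.
  by apply: P_DP_minimum gE _ => // k i j; apply: vertex_weight_odd_odd.
have mn0 : m%:R != 0 :> rat by rewrite pnatr_eq0 -lt0n.
apply: (mulIf mn0); rewrite (divfK mn0) gE.
(* The total is [m * K], so clearing the denominator leaves two factors [m], which turn the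
   coefficients into their closed forms. *)
transitivity ((m%:R - 1) * (m%:R * c a) * (m%:R * c b) - m%:R * (m%:R * c b)
  - m%:R * (m%:R * c a)); first by rewrite /K; ring.
by rewrite /c (walk_coef_odd m0 op) (walk_coef_odd m0 oq) [_ ^+ (a + b).+1]exprS exprD; ring.
Qed.

Lemma P_DP_odd_even (V : finType) (G : rel V) (m : nat) (x y : V) (p q : seq V) :
  edge_and_two_paths G x y p q -> ~~ odd (size p).+1 -> odd (size q).+1 ->
  (0 < size p)%N -> (0 < size q)%N -> (1 < m)%N ->
  exists n : nat, P_DP_is G m n /\
    (n%:R : rat) = ((m%:R - 1) ^+ ((size p).+1 + (size q).+1).+1 - (m%:R - 1) ^+ (size p).+1
                    - (m%:R - 1) ^+ (size q).+2 + 1) / m%:R.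
Proof.
move=> Gxy op oq p0 q0 m1; have m0 : (0 < m)%N by rewrite ltnW.
(* Only the path with an odd number of edges is twisted; one derangement suffices, so two colors are
   enough. *)
have [t [_ [t_der _]]] := exists_derangements m1.
have [g gE] := n_avoiding_twisted 1%g t m0 Gxy p0 q0.
pose c := walk_coef (m%:R - 1 : rat); set a := (size p).+1; set b := (size q).+1.
pose K := (m%:R - 1) * c a * c b - c a.
have weightE i : vertex_weight a b i ((1%g : {perm 'I_m}) i) (t i) = K.
  rewrite /vertex_weight perm1 eqxx t_der -(signr_odd _ a) -(signr_odd _ b) (negPf op) oq.
  by rewrite /K /c andbF /= ?mulr1n ?mulr0n ?expr1 ?expr0; ring.
rewrite (sum_const_ord weightE) in gE.
exists (n_avoiding (fun u v => g u v * (g v u)^-1)%g x y p q); split.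
  by apply: P_DP_minimum gE _ => // k i j; apply: vertex_weight_even_odd.
have mn0 : m%:R != 0 :> rat by rewrite pnatr_eq0 -lt0n.
apply: (mulIf mn0); rewrite (divfK mn0) gE.
transitivity ((m%:R - 1) * (m%:R * c a) * (m%:R * c b) - m%:R * (m%:R * c a)).
  by rewrite /K; ring.
by rewrite /c (walk_coef_even m0 op) (walk_coef_odd m0 oq) [_ ^+ b.+1]exprS
  [_ ^+ (a + b).+1]exprS exprD; ring.
Qed.

Theorem mainTheorem15 :
  (* (i) *)
  (forall (k l : nat) (V : finType) (G : rel V) (cA cB : seq V),
     (1 <= k <= l)%N -> size cA = (2 * k + 1)%N -> size cB = (2 * l + 1)%N ->
     is_cycle_sum G cA cB ->
     forall m : nat, P_DP_is G m (chrom G m)) /\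
  (* (ii) *)
  (forall (k l : nat) (V : finType) (G : rel V) (cA cB : seq V),
     (1 <= k <= l)%N -> size cA = (2 * k + 2)%N -> size cB = (2 * l + 2)%N ->
     is_cycle_sum G cA cB ->
     forall m : nat, (3 <= m)%N -> exists n : nat, P_DP_is G m n /\
     (n%:R : rat) = ((m%:R - 1) ^+ (2 * k + 2 * l + 3) - (m%:R - 1) ^+ (2 * l + 1)
                     - (m%:R - 1) ^+ (2 * k + 1) - m%:R - 1) / m%:R) /\
  (* (iii) *)
  (forall (k l : nat) (V : finType) (G : rel V) (cA cB : seq V),
     (1 <= k)%N -> (1 <= l)%N -> size cA = (2 * k + 1)%N -> size cB = (2 * l + 2)%N ->
     is_cycle_sum G cA cB ->
     forall m : nat, (2 <= m)%N -> exists n : nat, P_DP_is G m n /\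
     (n%:R : rat) = ((m%:R - 1) ^+ (2 * k + 2 * l + 2) - (m%:R - 1) ^+ (2 * k)
                     - (m%:R - 1) ^+ (2 * l + 2) + 1) / m%:R).
Proof.
split; [|split] => k l V G cA cB.
- move=> /andP[k1 kl] sA sB /cycle_sum_two_paths[x [y [p [q [Gxy sp sq]]]]] m.
  by apply: P_DP_odd_odd Gxy _ _; lia.
- move=> /andP[k1 kl] sA sB /cycle_sum_two_paths[x [y [p [q [Gxy sp sq]]]]] m m3.
  (* A cycle of length [n] opens into a path of [n - 1] edges, whence the shift in the exponents. *)
  have ep : ((2 * k + 1) = (size p).+1)%N by lia.
  have eq : ((2 * l + 1) = (size q).+1)%N by lia.
  have -> : ((2 * k + 2 * l + 3) = ((size p).+1 + (size q).+1).+1)%N by lia.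
  by rewrite ep eq; apply: P_DP_even_even Gxy _ _ _ _ _ => //; lia.
move=> k1 l1 sA sB /cycle_sum_two_paths[x [y [p [q [Gxy sp sq]]]]] m m2.
have ep : (2 * k = (size p).+1)%N by lia.
have eq : ((2 * l + 2) = (size q).+2)%N by lia.
have -> : ((2 * k + 2 * l + 2) = ((size p).+1 + (size q).+1).+1)%N by lia.
by rewrite ep eq; apply: P_DP_odd_even Gxy _ _ _ _ _ => //; lia.
Qed.
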